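(* Let $n=2$ and $A=\frac12\begin{pmatrix}0&1\\1&0\end{pmatrix}$. Let $\mu,\sigma\in\mathbb{R}^2$ be any feasible parameter values, i.e. $\mu_i\in[0,1]$ and $0\le\sigma_i\le\sqrt{\mu_i(1-\mu_i)}$ for $i=1,2$. Let $$v^* = \max\left\{\mathbb{E}_{\mathbb{P}}[\tilde\xi^TA\tilde\xi] : \mathbb{P}\in\mathcal{P}([0,1]^2),\ \mathbb{E}_{\mathbb{P}}[\tilde\xi]=\mu,\ \mathbb{E}_{\mathbb{P}}[\mathrm{diag}(\tilde\xi\tilde\xi^T)]=\mathrm{diag}(\mu\mu^T+\sigma\sigma^T)\right\}$$ and $$v^*_{\rm SDP}=\max\left\{A\bullet\Sigma : \Sigma\in\mathbb{S}^2,\ \mathrm{diag}(\Sigma)=\mathrm{diag}(\mu\mu^T+\sigma\sigma^T),\ \Sigma\le e\mu^T,\ \begin{pmatrix}1&\mu^T\\ \mu&\Sigma\end{pmatrix}\succeq 0\right\}.$$ Then, for every $\mathbb{P}$ feasible for the first problem, $$\mathbb{E}_{\mathbb{P}}[\tilde\xi_1\tilde\xi_2]\le v^*=v^*_{\rm SDP}=\min\left(\mu_1,\ \mu_2,\ \mu_1\mu_2+\sigma_1\sigma_2\right),$$ and this bound is best possible (attained by some feasible $\mathbb{P}$) for all feasible parameter values $\mu_i=\mathbb{E}_{\mathbb{P}}[\tilde\xi_i]$ and $\sigma_i=\sqrt{\mathrm{Var}[\tilde\xi_i]}$, $i=1,2$.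
   Context: $\mathbb{S}^2$ is the space of symmetric real $2\times2$ matrices; $\mathcal{P}([0,1]^2)$ is the set of probability distributions with support contained in $[0,1]^2$, and $\tilde\xi=(\tilde\xi_1,\tilde\xi_2)$ is the random vector with distribution $\mathbb{P}$; note $\tilde\xi^TA\tilde\xi=\tilde\xi_1\tilde\xi_2$. $e$ is the all-ones vector; $A\bullet B=\mathrm{trace}(A^TB)$; $\mathrm{diag}(A)$ is the vector of diagonal entries of $A$; $\Sigma\le e\mu^T$ is entrywise, i.e. $\Sigma_{ij}\le\mu_j$; $\succeq 0$ means positive semidefinite. *)

(* Defs.v *)
From HB Require Import structures.
From mathcomp Require Import all_boot all_order all_algebra.
From mathcomp Require Import all_classical all_reals all_analysis.
Set Implicit Arguments.
Unset Strict Implicit.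
Unset Printing Implicit Defensive.
Import Order.TTheory GRing.Theory Num.Theory.
Import numFieldNormedType.Exports.
Local Open Scope classical_set_scope.
Local Open Scope ring_scope.

Definition is_max {d} {T : porderType d} (S : set T) (m : T) : Prop :=
  S m /\ ubound S m.

Definition diagv {R : realType} n (M : 'M[R]_n) : 'cV[R]_n := \col_i M i i.

(* Trace inner product, written A \bullet B on paper. *)
Definition mxdot {R : realType} n (A B : 'M[R]_n) : R := \tr (A^T *m B).

Definition psd {R : realType} n (M : 'M[R]_n) : Prop :=
  M^T = M /\ forall x : 'cV[R]_n, 0 <= (x^T *m M *m x) 0 0.

Definition feasible_params {R : realType} (mu sigma : 'cV[R]_2) : Prop :=
  forall i : 'I_2, [/\ 0 <= mu i 0, mu i 0 <= 1, 0 <= sigma i 0 &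
    sigma i 0 <= Num.sqrt (mu i 0 * (1 - mu i 0))].

Definition unit_square {R : realType} : set (R * R) := `[0, 1] `*` `[0, 1].

(* Topological support; every open subset of the plane belongs to the product
   sigma-algebra, which is the Borel one. *)
Definition supp {R : realType} (P : probability (R * R)%type R)
  : set (R * R) :=
  [set x | forall U : set (R * R), open U -> U x -> (0 < P U)%E].

(* Distributions live on R * R; xi is the identity random vector on that space,
   presented as a column. *)
Definition xi {R : realType} (w : R * R) : 'cV[R]_2 :=
  \col_(i < 2) (if i == 0 then w.1 else w.2).

Definition expect_vec {R : realType} (P : probability (R * R)%type R)
    n (X : R * R -> 'cV[R]_n) : 'cV[\bar R]_n :=
  \col_i ('E_P[fun w => (X w i 0)%R])%E.

Definition A2 {R : realType} : 'M[R]_2 :=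
  2^-1 *: \matrix_(i, j) (if i == j then 0 else 1).

Definition second_moments {R : realType} (mu sigma : 'cV[R]_2) : 'cV[R]_2 :=
  diagv (mu *m mu^T + sigma *m sigma^T).

Definition moment_feasible {R : realType} (mu sigma : 'cV[R]_2)
    (P : probability (R * R)%type R) : Prop :=
  [/\ supp P `<=` unit_square,
      expect_vec P xi = map_mx EFin mu &
      expect_vec P (fun w => diagv (xi w *m (xi w)^T)) =
        map_mx EFin (second_moments mu sigma)].

Definition moment_values {R : realType} (mu sigma : 'cV[R]_2) : set (\bar R) :=
  [set v | exists2 P : probability (R * R)%type R, moment_feasible mu sigma P &
    v = ('E_P[fun w => (((xi w)^T *m A2 *m xi w) 0 0)%R])%E].

Definition sdp_feasible {R : realType} (mu sigma : 'cV[R]_2)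
    (Sigma : 'M[R]_2) : Prop :=
  [/\ Sigma^T = Sigma,
      diagv Sigma = second_moments mu sigma,
      forall i j : 'I_2, Sigma i j <= ((const_mx 1 : 'cV[R]_2) *m mu^T) i j &
      psd (block_mx (1%:M : 'M[R]_1) mu^T mu Sigma)].

Definition sdp_values {R : realType} (mu sigma : 'cV[R]_2) : set R :=
  [set v | exists2 Sigma : 'M[R]_2, sdp_feasible mu sigma Sigma &
    v = mxdot A2 Sigma].

(* Main.v *)
Require Import Defs.
From HB Require Import structures.
From mathcomp Require Import all_boot all_order all_algebra.
From mathcomp Require Import all_classical all_reals all_analysis.
From mathcomp Require Import measurable_realfun.
From mathcomp Require Import ring lra.
Set Implicit Arguments.
Unset Strict Implicit.
Unset Printing Implicit Defensive.
Import Order.TTheory GRing.Theory Num.Theory.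
Import numFieldNormedType.Exports.
Local Open Scope classical_set_scope.
Local Open Scope ring_scope.

(* On the square, [x * y <= x] and [x * y <= y], and Cauchy-Schwarz bounds the
   covariance by [sigma1 * sigma2]; in the semidefinite program the entrywise
   constraint and the positive semidefinite one give the same three bounds.
   All of them are attained by at most three atoms. If the covariance bound is
   the smallest one, take two atoms on a line of slope [sigma2 / sigma1]. If
   [mu1] is the smallest one, [x * y = x] must hold almost surely, so the mass
   lies on the edges [x = 0] and [y = 1]: put atoms at [(a, 1)], [(0, 1 - b)]
   and the corner [(0, 1)], where [a] and [b] are as large as the moments
   allow, so that the weights of the first two atoms are least. *)

(** * Optimal distributions with at most three atoms, in real arithmetic *)

Definition atomic_moments {R : realType} (w x y : 'I_3 -> R)
    (m1 m2 q1 q2 c : R) : Prop :=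
  [/\ forall k, [/\ 0 <= w k, 0 <= x k <= 1 & 0 <= y k <= 1],
      \sum_k w k = 1,
      \sum_k w k * x k = m1 /\ \sum_k w k * y k = m2,
      \sum_k w k * x k ^+ 2 = q1 /\ \sum_k w k * y k ^+ 2 = q2 &
      \sum_k w k * (x k * y k) = c].

Lemma atomic_moments_swap {R : realType} (w x y : 'I_3 -> R)
    (m1 m2 q1 q2 c : R) :
  atomic_moments w x y m1 m2 q1 q2 c -> atomic_moments w y x m2 m1 q2 q1 c.
Proof.
move=> [pos w1 [? ?] [? ?] wc]; split=> //.
- by move=> k; have [] := pos k.
- by rewrite -wc; apply: eq_bigr => k _; rewrite (mulrC (y k)).
Qed.

(** A two-point law with mean [m] and deviation [s] has atoms [m - s * p] and [m + s / p], where
    [p ^+ 2] is the ratio of the upper weight to the lower one. The four inequalities say that one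
    common [p] keeps both coordinates of both atoms in [[0, 1]]. *)
Lemma comonotone_scale {R : realType} (m1 m2 s1 s2 : R) :
  0 <= m1 <= 1 -> 0 <= m2 <= 1 -> 0 <= s1 -> 0 <= s2 ->
  s1 ^+ 2 <= m1 * (1 - m1) -> s2 ^+ 2 <= m2 * (1 - m2) ->
  m1 * m2 + s1 * s2 <= m1 -> m1 * m2 + s1 * s2 <= m2 ->
  exists2 p : R, 0 < p &
    [/\ s1 * p <= m1, s2 * p <= m2, s1 / p <= 1 - m1 & s2 / p <= 1 - m2].
Proof.
have scale_of a b s t : 0 <= a <= 1 -> 0 <= b <= 1 -> 0 < s -> 0 <= t ->
    s ^+ 2 <= a * (1 - a) -> a * b + s * t <= a -> a * t <= b * s ->
    exists2 p : R, 0 < p &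
      [/\ s * p <= a, t * p <= b, s / p <= 1 - a & t / p <= 1 - b].
  move=> /andP[a0 a1] /andP[b0 b1] s0 t0 sa ab at_.
  have {}a0 : 0 < a by rewrite lt_def a0 andbT; apply/eqP => a_eq0; nra.
  (* The largest [p] that the first coordinate allows, which puts its lower atom at [0];
     [a * t <= b * s] says that the other coordinate allows it too. The upper atom then fits by the
     variance bound in the first coordinate and by [a * b + s * t <= a] in the second. *)
  exists (a / s); first exact: divr_gt0.
  split.
  - by rewrite mulrCA divff ?gt_eqF// mulr1.
  - by rewrite mulrA ler_pdivrMr// mulrC.
  - by rewrite invf_div mulrA ler_pdivrMr//; nra.
  - by rewrite invf_div mulrA ler_pdivrMr//; nra.
move=> h1 h2 s10 s20 sm1 sm2 c1 c2.
(* A coordinate of zero deviation does not constrain [p], so the other one dictates the choice;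
   otherwise the smaller of [m1 / s1] and [m2 / s2] is taken. *)
have [s1_0|s1_n0] := eqVneq s1 0; have [s2_0|s2_n0] := eqVneq s2 0.
- by subst; exists 1 => //; split; lra.
- have [|||||||p p0 [? ? ? ?]] := @scale_of m2 m1 s2 s1 => //.
  + by rewrite lt_def s2_n0.
  + by rewrite mulrC (mulrC s2).
  + by subst s1; rewrite mulr0; apply: mulr_ge0 => //; lra.
  + by exists p.
- have [|||||||p p0 [? ? ? ?]] := @scale_of m1 m2 s1 s2 => //.
  + by rewrite lt_def s1_n0.
  + by subst s2; rewrite mulr0; apply: mulr_ge0 => //; lra.
  + by exists p.
- have {s1_n0}s1_0 : 0 < s1 by rewrite lt_def s1_n0.
  have {s2_n0}s2_0 : 0 < s2 by rewrite lt_def s2_n0.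
  have [le12|/ltW le21] := leP (m1 * s2) (m2 * s1).
    exact: scale_of.
  have [|||||||p p0 [? ? ? ?]] := @scale_of m2 m1 s2 s1 => //.
  + by rewrite mulrC (mulrC s2).
  + by exists p.
Qed.

Lemma comonotone_atoms {R : realType} (m1 m2 s1 s2 : R) :
  0 <= m1 <= 1 -> 0 <= m2 <= 1 -> 0 <= s1 -> 0 <= s2 ->
  s1 ^+ 2 <= m1 * (1 - m1) -> s2 ^+ 2 <= m2 * (1 - m2) ->
  m1 * m2 + s1 * s2 <= m1 -> m1 * m2 + s1 * s2 <= m2 ->
  exists w x y : 'I_3 -> R, atomic_moments w x y m1 m2
    (m1 ^+ 2 + s1 ^+ 2) (m2 ^+ 2 + s2 ^+ 2) (m1 * m2 + s1 * s2).
Proof.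
move=> h1 h2 s10 s20 sm1 sm2 c1 c2.
have [p p0 [lo1 lo2 hi1 hi2]] := comonotone_scale h1 h2 s10 s20 sm1 sm2 c1 c2.
have p_n0 : p != 0 by rewrite gt_eqF.
have d0 : 0 < 1 + p ^+ 2 by rewrite ltr_wpDr// exprn_ge0// ltW.
have d_n0 : 1 + p ^+ 2 != 0 by rewrite gt_eqF.
(* Only two atoms are listed: the default value [0] of the sequences makes the third one a point of
   weight zero at the origin. *)
exists (fun k => [:: (1 + p ^+ 2)^-1; p ^+ 2 / (1 + p ^+ 2)]`_k),
  (fun k => [:: m1 - s1 * p; m1 + s1 / p]`_k),
  (fun k => [:: m2 - s2 * p; m2 + s2 / p]`_k).
have s1p : 0 <= s1 * p by rewrite mulr_ge0// ltW.
have s2p : 0 <= s2 * p by rewrite mulr_ge0// ltW.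
have s1q : 0 <= s1 / p by rewrite divr_ge0// ltW.
have s2q : 0 <= s2 / p by rewrite divr_ge0// ltW.
split; rewrite ?big_ord_recl ?big_ord0 /=; first last.
- by field; rewrite p_n0.
- by split; field; rewrite p_n0.
- by split; field; rewrite p_n0.
- by field.
- move=> [[|[|[|//]]] /= _]; split; try lra.
  + by rewrite invr_ge0 ltW.
  + by rewrite divr_ge0 ?exprn_ge0// ltW.
Qed.

(* [a] and [m ^+ 2 / (m ^+ 2 + s ^+ 2)] are the position and the weight of the
   atom which, together with an atom at [0], realizes the mean [m] and the
   variance [s ^+ 2]; this weight is the least possible mass outside [0]. For
   [m = 0], where [s = 0], the weight is the junk value [0 / 0 = 0]. *)
Lemma extremal_atom {R : realType} (m s : R) :
  0 <= m -> s ^+ 2 <= m * (1 - m) ->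
  exists a, let t := m ^+ 2 / (m ^+ 2 + s ^+ 2) in
    [/\ 0 <= a <= 1, 0 <= t <= 1, t * a = m & t * a ^+ 2 = m ^+ 2 + s ^+ 2].
Proof.
move=> m0 sm; have s0 : 0 <= s ^+ 2 by exact: sqr_ge0.
have [m_0|m_n0] := eqVneq m 0.
  have {s0 sm} -> : s ^+ 2 = 0 by subst m; lra.
  by exists 0; subst m; rewrite expr0n/= !mul0r addr0 lexx ler01.
have {m_n0}m0 : 0 < m by rewrite lt_def m_n0.
have q0 : 0 < m ^+ 2 + s ^+ 2 by nra.
have q_n0 : m ^+ 2 + s ^+ 2 != 0 by rewrite gt_eqF.
have m_n0 : m != 0 by rewrite gt_eqF.
exists ((m ^+ 2 + s ^+ 2) / m) => t; rewrite /t; split.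
- by apply/andP; split; [rewrite divr_ge0// ltW|rewrite ler_pdivrMr//; lra].
- apply/andP; split; first by rewrite divr_ge0 ?exprn_ge0 // ltW.
  by rewrite ler_pdivrMr//; lra.
- by field; rewrite m_n0.
- by field; rewrite m_n0.
Qed.

(** After clearing denominators the inequality reduces to [(m * n) ^+ 2 <= (s * t) ^+ 2]. It leaves
    a nonnegative weight for the corner atom [(0, 1)]. *)
Lemma extremal_weights {R : realType} (m n s t : R) :
  0 <= m -> 0 <= n -> 0 <= s -> 0 <= t -> m * n <= s * t ->
  m ^+ 2 / (m ^+ 2 + s ^+ 2) + n ^+ 2 / (n ^+ 2 + t ^+ 2) <= 1.
Proof.
move=> m0 n0 s0 t0 mn_st.
have frac_le1 (a b : R) : a ^+ 2 / (a ^+ 2 + b ^+ 2) <= 1.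
  have [->|q_n0] := eqVneq (a ^+ 2 + b ^+ 2) 0; first by rewrite invr0 mulr0.
  have q0 : 0 < a ^+ 2 + b ^+ 2 by rewrite lt_def q_n0 addr_ge0 ?sqr_ge0.
  by rewrite ler_pdivrMr// mul1r lerDl sqr_ge0.
have [->|m_n0] := eqVneq m 0; first by rewrite expr0n mul0r add0r.
have [->|n_n0] := eqVneq n 0; first by rewrite expr0n mul0r addr0.
have q0 : 0 < m ^+ 2 + s ^+ 2 by rewrite ltr_wpDr ?sqr_ge0// exprn_even_gt0.
have r0 : 0 < n ^+ 2 + t ^+ 2 by rewrite ltr_wpDr ?sqr_ge0// exprn_even_gt0.
have mn_st2 : (m * n) ^+ 2 <= (s * t) ^+ 2.
  by rewrite ler_pXn2r// nnegrE mulr_ge0.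
by rewrite addf_div ?gt_eqF// ler_pdivrMr ?mulr_gt0//; lra.
Qed.

(** [extremal_atom] serves the first coordinate and, after the reflection [y -> 1 - y], the second.
    The last hypothesis reads [m1 * (1 - m2) <= s1 * s2], which is what [extremal_weights] asks for
    the two weights to fit on disjoint atoms. *)
Lemma edge_atoms {R : realType} (m1 m2 s1 s2 : R) :
  0 <= m1 -> m2 <= 1 -> 0 <= s1 -> 0 <= s2 ->
  s1 ^+ 2 <= m1 * (1 - m1) -> s2 ^+ 2 <= m2 * (1 - m2) ->
  m1 <= m1 * m2 + s1 * s2 ->
  exists w x y : 'I_3 -> R, atomic_moments w x y m1 m2
    (m1 ^+ 2 + s1 ^+ 2) (m2 ^+ 2 + s2 ^+ 2) m1.
Proof.
move=> m10 m21 s10 s20 sm1 sm2 c1.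
have n0 : 0 <= 1 - m2 by lra.
have sn : s2 ^+ 2 <= (1 - m2) * (1 - (1 - m2)) by lra.
have tu : m1 * (1 - m2) <= s1 * s2 by lra.
have {tu} := extremal_weights m10 n0 s10 s20 tu.
have [a] := extremal_atom m10 sm1.
have [b] := extremal_atom n0 sn.
set t := m1 ^+ 2 / _; set u := (1 - m2) ^+ 2 / _ => /=.
move=> [b01 u01 ub ubb] [a01 t01 ta taa] tu.
exists (fun k => [:: t; u; 1 - t - u]`_k), (fun k => [:: a; 0; 0]`_k),
  (fun k => [:: 1; 1 - b; 1]`_k).
split; rewrite ?big_ord_recl ?big_ord0 /=; first last.
- by rewrite -ta; ring.
- split; first by rewrite -taa; ring.
  (* The second moment is expanded around [y = 1] to expose the known quantities [u * b] and
     [u * b ^+ 2]. *)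
  transitivity (1 - 2 * (u * b) + u * b ^+ 2); first by ring.
  by rewrite ub ubb; ring.
- split; first by rewrite -ta; ring.
  transitivity (1 - u * b); first by ring.
  by rewrite ub; ring.
- by ring.
- by move=> [[|[|[|//]]] /= _]; split; lra.
Qed.

(** * Finitely supported probabilities and their expectations *)

Lemma exists_discrete_probability d (T : measurableType d) (R : realType)
    n (w : 'I_n -> R) (p : 'I_n -> T) :
  (forall k, 0 <= w k) -> \sum_k w k = 1 ->
  exists P : probability T R,
    (forall A, P A = \sum_k (w k)%:E * \d_(p k) A)%E /\
    forall f : T -> R, measurable_fun setT f ->
      ('E_P[f] = (\sum_k w k * f (p k))%:E)%E.
Proof.
move=> w0 w1.
case: n w p w0 w1 => [|n] w p w0 w1.
  by move: w1; rewrite big_ord0 => /eqP; rewrite eq_sym oner_eq0.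
pose m k : {measure set T -> \bar R} :=
  mscale (NngNum (w0 (inord k))) (\d_(p (inord k))).
have msumE A : msum m n.+1 A = (\sum_k (w k)%:E * \d_(p k) A)%E.
  by apply: eq_bigr => k _; rewrite /m/= /mscale/= !inord_val.
have m1 : msum m n.+1 setT = 1%E.
  rewrite msumE; under eq_bigr do rewrite diracT mule1.
  by rewrite sumEFin w1.
pose P : probability T R :=
  HB.pack_for (probability T R) (Measure.sort (msum m n.+1))
    (Measure_isProbability.Build _ _ _ (msum m n.+1) m1).
exists P; split=> // f mf.
(* The formula for nonnegative functions is applied below to the positive and negative parts of [f];
   all sums are finite, so their difference is harmless. *)
have pos_int (g : T -> \bar R) : measurable_fun setT g ->
    (forall x, 0 <= g x)%E -> (\int[P]_x g x = \sum_k (w k)%:E * g (p k))%E.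
  move=> mg g0.
  rewrite (ge0_integral_measure_sum m measurableT)//.
  apply: eq_bigr => k _.
  by rewrite ge0_integral_mscale//= !inord_val integral_dirac// diracT mul1e.
have mfE : measurable_fun setT (EFin \o f) by exact/measurable_EFinP.
rewrite unlock integralE.
rewrite (pos_int _ (measurable_funepos mfE))//.
rewrite (pos_int _ (measurable_funeneg mfE))//.
rewrite (eq_bigr (fun k => (w k * Num.max (f (p k)) 0)%:E)); last first.
  by move=> k _; rewrite funeposE/= -EFin_max -EFinM.
rewrite [X in (_ - X)%E](eq_bigr (fun k => (w k * Num.max (- f (p k)) 0)%:E)); last first.
  by move=> k _; rewrite funenegE/= -EFin_max -EFinM.
rewrite !sumEFin -EFinB -sumrB; congr EFin; apply: eq_bigr => k _.
rewrite -mulrBr; congr *%R.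
by case: (leP 0 (f (p k))); case: (leP (- f (p k)) 0); lra.
Qed.

(** * Topological support and null sets in the plane *)

(** A base of the plane indexed by a countable type, so that unions over it become sequences through
    [pickle]. *)
Definition rat_box {R : realType} (q : rat * rat * (rat * rat)) :
    set (R * R) :=
  `]ratr q.1.1, ratr q.1.2[ `*` `]ratr q.2.1, ratr q.2.2[.

Lemma measurable_rat_box {R : realType} q : measurable (@rat_box R q).
Proof. exact: measurableX. Qed.

Lemma open_rat_box {R : realType} (U : set (R * R)) (x : R * R) :
  open U -> U x -> exists q, rat_box q x /\ rat_box q `<=` U.
Proof.
move=> oU Ux.
case: (open_nbhs_nbhs (conj oU Ux)) => -[V1 V2]/= [V1x V2x] V12.
have rat_itv (y : R) (V : set R) : nbhs y V -> exists q : rat * rat,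
    `]ratr q.1, ratr q.2[%classic y /\ `]ratr q.1, ratr q.2[ `<=` V.
  move=> /nbhs_ballP[e /= e0 yV].
  have /rat_in_itvoo[a] : y - e < y by rewrite ltrBlDr ltrDl.
  have /rat_in_itvoo[b] : y < y + e by rewrite ltrDl.
  rewrite !in_itv/= => /andP[yb be] /andP[ea ay].
  exists (a, b); split; first by rewrite /= in_itv/= ay yb.
  move=> z /=; rewrite in_itv/= => /andP[az zb]; apply: yV.
  by rewrite ball_itv/= in_itv/= (lt_trans ea az) (lt_trans zb be).
have [q1 [xq1 qV1]] := rat_itv _ _ V1x.
have [q2 [xq2 qV2]] := rat_itv _ _ V2x.
by exists (q1, q2); split=> // z [/qV1 z1 /qV2 z2]; exact: V12.
Qed.

Lemma open_measurable_plane {R : realType} (U : set (R * R)) :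
  open U -> measurable U.
Proof.
move=> oU.
have -> : U = \bigcup_n if unpickle n is Some q then
    if `[< @rat_box R q `<=` U >] then rat_box q else set0 else set0.
  apply/seteqP; split=> [x /(open_rat_box oU)[q [xq qU]]|x [n _]].
    exists (pickle q); first exact: Logic.I.
    by rewrite pickleK; case: asboolP.
  by case: unpickle => // q; case: asboolP => // qU /qU.
apply: bigcupT_measurable => n; case: unpickle => // q.
by case: ifP => // _; exact: measurable_rat_box.
Qed.

(** Each point off the support lies in a null open set, hence in a null rational box; there are
    countably many such boxes, so their union is negligible. *)
Lemma supp_null {R : realType} (P : probability (R * R)%type R)
    (A : set (R * R)) : measurable A -> supp P `<=` A -> P (~` A) = 0%E.
Proof.
move=> mA PA.
pose N n : set (R * R) := if unpickle n is Some q then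
  if P (rat_box q) == 0%E then rat_box q else set0 else set0.
have PN n : P.-negligible (N n).
  rewrite /N; case: unpickle => [q|]; last exact: negligible_set0.
  case: ifP => [/eqP Pq|_]; last exact: negligible_set0.
  by exists (rat_box q); split=> //; exact: measurable_rat_box.
suff: P.-negligible (~` A) by move/(measure_negligible (measurableC mA)).
apply: negligibleS (negligible_bigcup PN) => x Ax.
have : ~ supp P x by move/PA.
move/existsNP => [U /not_implyP[oU /not_implyP[Ux /negP]]].
rewrite -leNgt => PU0.
have [q [xq qU]] := open_rat_box oU Ux.
exists (pickle q); first exact: Logic.I.
rewrite /N pickleK ifT//.
rewrite eq_le measure_ge0 andbT (le_trans _ PU0)//.
by apply: le_measure => //; rewrite inE;
  [exact: measurable_rat_box|exact: open_measurable_plane].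
Qed.

Lemma closed_unit_square {R : realType} : closed (@unit_square R).
Proof.
have -> : @unit_square R = fst @^-1` `[0, 1] `&` snd @^-1` `[0, 1] by [].
apply: closedI; apply: closed_comp; try exact: itv_closed.
- by move=> x _; exact: cvg_fst.
- by move=> x _; exact: cvg_snd.
Qed.

Lemma measurable_unit_square {R : realType} : measurable (@unit_square R).
Proof. exact: measurableX. Qed.

(** * Moments of the coordinates and the upper bound for distributions *)

Lemma xi0E {R : realType} : (fun w : R * R => xi w 0 0) = fst.
Proof. by apply/funext => w; rewrite mxE. Qed.

Lemma xi1E {R : realType} : (fun w : R * R => xi w 1 0) = snd.
Proof. by apply/funext => w; rewrite mxE. Qed.

Lemma measurable_xi {R : realType} (i : 'I_2) :
  measurable_fun setT (fun w : R * R => xi w i 0).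
Proof.
case: i => -[|[|//]] lti.
- by rewrite (_ : Ordinal lti = 0) ?xi0E//; exact: val_inj.
- by rewrite (_ : Ordinal lti = 1) ?xi1E//; exact: val_inj.
Qed.

Lemma quadratic_xi {R : realType} (w : R * R) :
  ((xi w)^T *m A2 *m xi w) 0 0 = w.1 * w.2.
Proof.
rewrite !mxE !big_ord_recl big_ord0 !mxE !big_ord_recl !big_ord0 !mxE/=.
by field.
Qed.

Lemma second_momentsE {R : realType} (mu sigma : 'cV[R]_2) i :
  second_moments mu sigma i 0 = mu i 0 ^+ 2 + sigma i 0 ^+ 2.
Proof. by rewrite !mxE !big_ord1 !mxE !expr2. Qed.

Lemma moment_feasibleP {R : realType} (mu sigma : 'cV[R]_2)
    (P : probability (R * R)%type R) :
  moment_feasible mu sigma P <->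
  [/\ supp P `<=` unit_square,
      forall i, ('E_P[fun w => xi w i 0%R] = (mu i 0)%:E)%E &
      forall i, ('E_P[fun w => (xi w i 0%R ^+ 2)%R] =
        (mu i 0 ^+ 2 + sigma i 0 ^+ 2)%:E)%E].
Proof.
have sqE i : (fun w : R * R => (diagv (xi w *m (xi w)^T)) i 0) =
    (fun w => xi w i 0 ^+ 2).
  by apply/funext => w; rewrite !mxE big_ord1 !mxE expr2.
split=> -[sP m1 m2]; split=> //.
- by move=> i; move/matrixP : m1 => /(_ i 0); rewrite !mxE.
- move=> i; move/matrixP : m2 => /(_ i 0).
  by rewrite [RHS]mxE second_momentsE mxE sqE.
- by apply/matrixP => i j; rewrite ord1 [RHS]mxE -m1 mxE.
- by apply/matrixP => i j; rewrite ord1 [RHS]mxE second_momentsE -m2 mxE sqE.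
Qed.

(** The coordinates are unbounded on the whole plane and bounded only on the square, hence the bound
    is asked on a set of full measure; there the square is at most [1], which is integrable. *)
Lemma bounded_Lfun2 d (T : measurableType d) (R : realType)
    (P : probability T R) (D : set T) (f : T -> R) :
  measurable D -> P (~` D) = 0%E -> measurable_fun setT f ->
  (forall w, D w -> `|f w| <= 1) -> f \in Lfun P 2%:E.
Proof.
move=> mD PD mf f1; rewrite inE; apply/andP; split; rewrite inE//=.
rewrite /finite_norm unlock poweR_lty//.
apply: (@le_lt_trans _ _ (\int[P]_x 1)%E); last first.
  by rewrite integral_cst//= mul1e probability_setT ltry.
apply: ae_ge0_le_integral => //.
- by move=> x _; rewrite poweR_ge0.
- apply/measurable_EFinP/(@measurableT_comp _ _ _ _ _ _ (@powR R ^~ 2)) => //.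
  exact: measurableT_comp.
- exists (~` D); split=> //; first exact: measurableC.
  move=> x /= nx Dx; apply: nx => _.
  by rewrite lee_fin powR_mulrn// exprn_ile1// f1.
Qed.

(** Both integrals may be restricted to [D], its complement being null; there the comparison is
    pointwise. *)
Lemma expectation_le_on d (T : measurableType d) (R : realType)
    (P : probability T R) (D : set T) (f g : T -> R) :
  measurable D -> P (~` D) = 0%E -> f \in Lfun P 1 -> g \in Lfun P 1 ->
  (forall w, D w -> f w <= g w) -> ('E_P[f] <= 'E_P[g])%E.
Proof.
move=> mD PD /Lfun1_integrable fi /Lfun1_integrable gi fg.
rewrite unlock (negligible_integral (measurableC mD))//.
rewrite [leRHS](negligible_integral (measurableC mD))// setTD setCK.
apply: le_integral => //.
- exact: integrableS fi.
- exact: integrableS gi.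
- by move=> w /set_mem Dw; rewrite lee_fin fg.
Qed.

Lemma unit_square_xi {R : realType} (w : R * R) i :
  unit_square w -> 0 <= xi w i 0 <= 1.
Proof. by rewrite /unit_square/= !in_itv/= mxE => -[? ?]; case: ifP. Qed.

Lemma Lfun2_xi {R : realType} (P : probability (R * R)%type R) i :
  supp P `<=` unit_square -> (fun w => xi w i 0) \in Lfun P 2%:E.
Proof.
have mD := @measurable_unit_square R.
move=> sP; apply: (bounded_Lfun2 mD (supp_null mD sP)); first exact: measurable_xi.
by move=> w /(unit_square_xi i)/andP[x0 x1]; rewrite ger0_norm.
Qed.

Lemma moment_feasible_variance {R : realType} (mu sigma : 'cV[R]_2)
    (P : probability (R * R)%type R) i : moment_feasible mu sigma P ->
  ('V_P[fun w => (xi w i 0)%R] = (sigma i 0 ^+ 2)%:E)%E.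
Proof.
move=> /moment_feasibleP[sP m1 m2]; rewrite varianceE ?Lfun2_xi//.
rewrite -[X in ('E_P[X])%E]/(fun w => xi w i 0 ^+ 2).
by rewrite m1 m2 -EFin_expe -EFinB; congr EFin; ring.
Qed.

Lemma moment_feasible_le {R : realType} (mu sigma : 'cV[R]_2)
    (P : probability (R * R)%type R) :
  (forall i, 0 <= sigma i 0) -> moment_feasible mu sigma P ->
  ('E_P[fun w => (w.1 * w.2)%R] <= (Num.min (mu 0 0) (Num.min (mu 1 0)
    (mu 0 0 * mu 1 0 + sigma 0 0 * sigma 1 0)))%:E)%E.
Proof.
move=> s0 feasP; have /moment_feasibleP[sP m1 m2] := feasP.
have mD := @measurable_unit_square R.
have PD := supp_null mD sP.
have sq := @unit_square_xi R.
have L2 i : (fun w => xi w i 0) \in Lfun P 2%:E by exact: Lfun2_xi.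
have L1 i : (fun w => xi w i 0) \in Lfun P 1.
  by apply: Lfun_subset12 (L2 i); exact: fin_num_measure.
have LXY := Lfun2_mul_Lfun1 (L2 0) (L2 1).
have XY : (fun w : R * R => w.1 * w.2) =
    ((fun w => xi w 0 0) \* (fun w => xi w 1 0)).
  by rewrite xi0E xi1E.
have V i := moment_feasible_variance i feasP.
rewrite XY !EFin_min !le_min; apply/and3P; split.
- rewrite -m1; apply: (expectation_le_on mD PD) => // w Dw /=.
  have /andP[? ?] := sq w 0 Dw; have /andP[? ?] := sq w 1 Dw.
  by rewrite ler_piMr.
- rewrite -m1; apply: (expectation_le_on mD PD) => // w Dw /=.
  have /andP[? ?] := sq w 0 Dw; have /andP[? ?] := sq w 1 Dw.
  by rewrite ler_piMl.
(* Cauchy-Schwarz for the covariance; the square root of [sigma i 0 ^+ 2] is [sigma i 0] because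
   deviations are nonnegative. *)
- have := covariance_le (L2 0) (L2 1).
  rewrite covarianceE// !V !m1 /sqrte/= !sqrtr_sqr !ger0_norm//.
  by rewrite -EFinM EFinN leeBlDr// -EFinD addrC.
Qed.

(** * The semidefinite program *)

Lemma mxdot_A2 {R : realType} (S : 'M[R]_2) : S^T = S -> mxdot A2 S = S 0 1.
Proof.
move=> /matrixP/(_ 0 1); rewrite !mxE => S10.
rewrite /mxdot /mxtrace !big_ord_recl big_ord0 !mxE !big_ord_recl !big_ord0.
rewrite !mxE/= (_ : lift ord0 ord0 = 1 :> 'I_2); last exact: val_inj.
by rewrite (_ : ord0 = 0 :> 'I_2) ?S10; [field|exact: val_inj].
Qed.

(** Completing the square in [x0]: what remains is the quadratic form of the Schur complement
    [S - m *m m^T]. *)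
Lemma sdp_form {R : realType} (m : 'cV[R]_2) (S : 'M[R]_2) (x0 : 'cV[R]_1)
    (x : 'cV[R]_2) : S^T = S ->
  ((col_mx x0 x)^T *m block_mx (1%:M : 'M[R]_1) m^T m S *m col_mx x0 x) 0 0 =
  (x0 0 0 + x 0 0 * m 0 0 + x 1 0 * m 1 0) ^+ 2 +
  (x 0 0 ^+ 2 * (S 0 0 - m 0 0 ^+ 2) + x 1 0 ^+ 2 * (S 1 1 - m 1 0 ^+ 2) +
   2 * (x 0 0 * x 1 0 * (S 0 1 - m 0 0 * m 1 0))).
Proof.
move=> /matrixP/(_ 0 1); rewrite mxE => S10.
rewrite tr_col_mx mul_row_block mul_row_col !mxE.
rewrite !big_ord_recl !big_ord0 !mxE !big_ord_recl !big_ord0 !mxE/=.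
rewrite (_ : lift ord0 ord0 = 1 :> 'I_2); last exact: val_inj.
have -> : ord0 = 0 :> 'I_2 by exact: val_inj.
have -> : ord0 = 0 :> 'I_1 by exact: val_inj.
rewrite S10; move: (x0 0 0) (x 0 0) (x 1 0) (m 0 0) (m 1 0) (S 0 0) (S 1 1).
by move: (S 0 1) => *; ring.
Qed.

(** At the vector [(s2, - s1)] the form equals [2 * (s1 * s2) * (s1 * s2 - d)], which settles the
    case of positive [s1] and [s2]. *)
Lemma psd_form_le {R : realType} (s1 s2 d : R) : 0 <= s1 -> 0 <= s2 ->
  (forall a b, 0 <= a ^+ 2 * s1 ^+ 2 + b ^+ 2 * s2 ^+ 2 + 2 * (a * b * d)) ->
  d <= s1 * s2.
Proof.
move=> s10 s20 q.
have [s1_0|s1_n0] := eqVneq s1 0.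
  rewrite {}s1_0 in q *; rewrite mul0r leNgt; apply/negP => d0.
  (* With [s1 = 0] the form is affine in [a], of slope [2 * d] when [b = 1], so a positive [d] lets
     it become negative; this [a] gives [- s2 ^+ 2 - 2]. *)
  have := q (- (s2 ^+ 2 + 1) / d) 1.
  have -> : (- (s2 ^+ 2 + 1) / d) ^+ 2 * 0 ^+ 2 + 1 ^+ 2 * s2 ^+ 2 +
      2 * (- (s2 ^+ 2 + 1) / d * 1 * d) = - s2 ^+ 2 - 2.
    by field; rewrite gt_eqF.
  by have := sqr_ge0 s2; lra.
have {s1_n0}s1_0 : 0 < s1 by rewrite lt_def s1_n0.
have [s2_0|s2_n0] := eqVneq s2 0.
  rewrite {}s2_0 in q *; rewrite mulr0 leNgt; apply/negP => d0.
  have := q 1 (- (s1 ^+ 2 + 1) / d).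
  have -> : 1 ^+ 2 * s1 ^+ 2 + (- (s1 ^+ 2 + 1) / d) ^+ 2 * 0 ^+ 2 +
      2 * (1 * (- (s1 ^+ 2 + 1) / d) * d) = - s1 ^+ 2 - 2.
    by field; rewrite gt_eqF.
  by have := sqr_ge0 s1; lra.
have {s2_n0}s2_0 : 0 < s2 by rewrite lt_def s2_n0.
have := q s2 (- s1).
have -> : s2 ^+ 2 * s1 ^+ 2 + (- s1) ^+ 2 * s2 ^+ 2 + 2 * (s2 * - s1 * d) =
    2 * (s1 * s2) * (s1 * s2 - d) by ring.
by rewrite pmulr_rge0 ?subr_ge0// !mulr_gt0.
Qed.

Lemma sdp_feasible_le {R : realType} (mu sigma : 'cV[R]_2) (S : 'M[R]_2) :
  (forall i, 0 <= sigma i 0) -> sdp_feasible mu sigma S ->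
  S 0 1 <= Num.min (mu 0 0)
    (Num.min (mu 1 0) (mu 0 0 * mu 1 0 + sigma 0 0 * sigma 1 0)).
Proof.
move=> s0 [Ssym /matrixP Sdiag Sle [_ Spsd]].
have Sii i : S i i = mu i 0 ^+ 2 + sigma i 0 ^+ 2.
  by rewrite -second_momentsE -Sdiag mxE.
have Sle' i j : S i j <= mu j 0.
  by have := Sle i j; rewrite !mxE big_ord1 !mxE mul1r.
have S10 : S 1 0 = S 0 1 by move/matrixP : Ssym => /(_ 0 1); rewrite mxE.
(* The entrywise constraint bounds [S 0 1] by [mu 1 0] and, through symmetry, by [mu 0 0]. *)
rewrite !le_min Sle' -{1}S10 Sle'/= -lerBlDl.
apply: psd_form_le => // a b.
pose x : 'cV[R]_2 := \col_i (if i == 0 then a else b).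
(* This first component makes the square in [sdp_form] vanish, leaving the form of the covariance
   matrix. *)
have := Spsd (col_mx (const_mx (- (a * mu 0 0 + b * mu 1 0))) x).
rewrite sdp_form// !mxE/= !Sii.
set l := (l in 0 <= l -> _); set r := (r in _ -> 0 <= r).
by have -> : l = r by rewrite /l /r; ring.
Qed.

(** Such a [c] corresponds to a covariance between [0] and the product of the deviations, for which
    the Schur complement is positive semidefinite. *)
Lemma sdp_feasible_corr {R : realType} (mu sigma : 'cV[R]_2) (c : R) :
  0 <= sigma 0 0 -> 0 <= sigma 1 0 ->
  (forall i, mu i 0 ^+ 2 + sigma i 0 ^+ 2 <= mu i 0) ->
  c <= mu 0 0 -> c <= mu 1 0 ->
  mu 0 0 * mu 1 0 <= c <= mu 0 0 * mu 1 0 + sigma 0 0 * sigma 1 0 ->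
  sdp_feasible mu sigma (\matrix_(i, j)
    (if i == j then mu i 0 ^+ 2 + sigma i 0 ^+ 2 else c)).
Proof.
move=> s0 s1 sm c0 c1 /andP[lc cu]; set S := (X in sdp_feasible _ _ X).
have Ssym : S^T = S.
  by apply/matrixP => i j; rewrite !mxE eq_sym; case: eqVneq => // ->.
split=> //.
- by apply/matrixP => i j; rewrite ord1 second_momentsE !mxE eqxx.
- move=> i j; rewrite !mxE big_ord1 !mxE mul1r.
  case: eqVneq => [->//|].
  by case: i j => -[|[|//]] ? [[|[|//]] ?] // _;
    [rewrite (_ : Ordinal _ = 1)|rewrite (_ : Ordinal _ = 0)] => //;
    exact: val_inj.
split.
  by rewrite tr_block_mx trmx1 trmxK Ssym.
move=> x; rewrite -[x](vsubmxK (m1 := 1)) sdp_form//.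
have SE i j : S i j = if i == j then mu i 0 ^+ 2 + sigma i 0 ^+ 2 else c.
  by rewrite mxE.
set x0 := usubmx x; set y := dsubmx x; rewrite !SE/=.
apply: addr_ge0; first exact: sqr_ge0.
rewrite ![_ + _ ^+ 2 - _]addrAC !subrr !add0r.
move: (y 0 0) (y 1 0) => a b.
move: (sigma 0 0) (sigma 1 0) s0 s1 cu => s t s0 t0 cu.
have [d [d0 dst cE]] : exists d : R, [/\ 0 <= d, d <= s * t & c - mu 0 0 * mu 1 0 = d].
  by exists (c - mu 0 0 * mu 1 0); split; lra.
rewrite cE.
(* For [a * b] nonnegative every term is nonnegative; otherwise [d <= s * t] bounds the form below
   by [(a * s + b * t) ^+ 2]. *)
have [ab0|ab0] := leP 0 (a * b).
  have := mulr_ge0 ab0 d0; have := sqr_ge0 (a * s); have := sqr_ge0 (b * t).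
  by lra.
have : a * b * (s * t) <= a * b * d by rewrite ler_nM2l.
by have := sqr_ge0 (a * s + b * t); lra.
Qed.

(** * Attainment and equality of the two optimal values *)

Lemma feasible_paramsP {R : realType} (mu sigma : 'cV[R]_2) i :
  feasible_params mu sigma ->
  [/\ 0 <= mu i 0 <= 1, 0 <= sigma i 0 &
      sigma i 0 ^+ 2 <= mu i 0 * (1 - mu i 0)].
Proof.
move=> /(_ i)[m0 m1 s0 s1]; split; rewrite ?m0//.
have v0 : 0 <= mu i 0 * (1 - mu i 0) by rewrite mulr_ge0 ?subr_ge0.
by rewrite -[leRHS]sqr_sqrtr// ler_pXn2r// nnegrE sqrtr_ge0.
Qed.

Lemma exists_optimal_atoms {R : realType} (mu sigma : 'cV[R]_2) :
  feasible_params mu sigma ->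
  exists w x y : 'I_3 -> R, atomic_moments w x y (mu 0 0) (mu 1 0)
    (mu 0 0 ^+ 2 + sigma 0 0 ^+ 2) (mu 1 0 ^+ 2 + sigma 1 0 ^+ 2)
    (Num.min (mu 0 0) (Num.min (mu 1 0)
      (mu 0 0 * mu 1 0 + sigma 0 0 * sigma 1 0))).
Proof.
move=> H; have [/andP[m0 m0'] s0 v0] := feasible_paramsP 0 H.
have [/andP[m1 m1'] s1 v1] := feasible_paramsP 1 H.
(* The cases decide which of the three bounds is smallest: a mean calls for the edge atoms, with the
   coordinates exchanged if it is [mu 1 0], and the covariance bound for the comonotone ones. *)
have [le1|/ltW ge1] := leP (mu 1 0) (mu 0 0 * mu 1 0 + sigma 0 0 * sigma 1 0).
  have [le0|ge0] := leP (mu 0 0) (mu 1 0).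
    by apply: edge_atoms => //; exact: le_trans le1.
  have [|||||||w [y [x A]]] := @edge_atoms _ (mu 1 0) (mu 0 0) (sigma 1 0)
    (sigma 0 0) => //.
    by rewrite mulrC (mulrC (sigma 1 0)).
  by exists w, x, y; exact: atomic_moments_swap.
have [le0|/ltW ge0] := leP (mu 0 0) (mu 0 0 * mu 1 0 + sigma 0 0 * sigma 1 0).
  exact: edge_atoms.
by apply: comonotone_atoms => //; rewrite ?m0 ?m1.
Qed.

Lemma exists_optimal {R : realType} (mu sigma : 'cV[R]_2) :
  feasible_params mu sigma ->
  exists P : probability (R * R)%type R,
    [/\ moment_feasible mu sigma P,
        ('E_P[fun w => (w.1 * w.2)%R])%E = (Num.min (mu 0 0) (Num.min (mu 1 0)
          (mu 0 0 * mu 1 0 + sigma 0 0 * sigma 1 0)))%:E &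
        forall i, 'V_P[fun w => xi w i 0%R]%E = (sigma i 0 ^+ 2)%:E].
Proof.
move=> H; have [w [x [y [bnd w1 [mx my] [qx qy] c]]]] := exists_optimal_atoms H.
have [P [PE Pexp]] := @exists_discrete_probability _ (R * R)%type R _ w
  (fun k => (x k, y k)) (fun k => let: And3 h _ _ := bnd k in h) w1.
have mxi := @measurable_xi R.
have E1 i : ('E_P[fun w => xi w i 0%R] = (mu i 0)%:E)%E.
  rewrite Pexp//; case: i => -[|[|//]] lti; congr EFin.
  - rewrite (_ : Ordinal lti = 0); last exact: val_inj.
    by rewrite -mx; apply: eq_bigr => k _; rewrite mxE.
  - rewrite (_ : Ordinal lti = 1); last exact: val_inj.
    by rewrite -my; apply: eq_bigr => k _; rewrite mxE.
have E2 i : ('E_P[fun w => (xi w i 0%R ^+ 2)%R] =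
    (mu i 0 ^+ 2 + sigma i 0 ^+ 2)%:E)%E.
  rewrite Pexp; last exact: measurable_funX.
  case: i => -[|[|//]] lti; congr EFin.
  - rewrite (_ : Ordinal lti = 0); last exact: val_inj.
    by rewrite -qx; apply: eq_bigr => k _; rewrite mxE.
  - rewrite (_ : Ordinal lti = 1); last exact: val_inj.
    by rewrite -qy; apply: eq_bigr => k _; rewrite mxE.
have sP : supp P `<=` unit_square.
  move=> z Pz; apply: contrapT => nz.
  (* The complement of the square is open and carries no atom, so it has mass zero and contains no
     support point. *)
  have := Pz _ (closed_openC closed_unit_square) nz.
  rewrite PE big1 ?ltxx// => k _; have [_ xk yk] := bnd k.
  by rewrite diracE memNset ?mule0// => -[]; split; rewrite /= in_itv.
have mP : moment_feasible mu sigma P by apply/moment_feasibleP.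
exists P; split=> //.
- by rewrite Pexp ?c//; exact: measurable_funM.
- by move=> i; exact: moment_feasible_variance mP.
Qed.

Theorem proposition10 (R : realType) (mu sigma : 'cV[R]_2)
    (Hpar : feasible_params mu sigma) :
  exists vstar vSDP : R,
    [/\ is_max (moment_values mu sigma) vstar%:E,
        is_max (sdp_values mu sigma) vSDP,
        forall P : probability (R * R)%type R, moment_feasible mu sigma P ->
          ('E_P[fun w => (w.1 * w.2)%R] <= vstar%:E)%E,
        vstar = vSDP /\
        vSDP = Num.min (mu 0 0)
          (Num.min (mu 1 0) (mu 0 0 * mu 1 0 + sigma 0 0 * sigma 1 0)) &
        exists P : probability (R * R)%type R,
          [/\ moment_feasible mu sigma P,
              ('E_P[fun w => (w.1 * w.2)%R])%E =
                (Num.min (mu 0 0) (Num.min (mu 1 0)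
                  (mu 0 0 * mu 1 0 + sigma 0 0 * sigma 1 0)))%:E,
              forall i : 'I_2, (mu i 0)%:E = ('E_P[fun w => (xi w i 0)%R])%E &
              forall i : 'I_2, (sigma i 0)%:E =
                (sqrte 'V_P[fun w => (xi w i 0)%R])%E]].
Proof.
have s0 i : 0 <= sigma i 0 by have [] := feasible_paramsP i Hpar.
have [P [feasP optP varP]] := exists_optimal Hpar.
have quadE (Q : probability (R * R)%type R) :
    ('E_Q[fun w => (((xi w)^T *m A2 *m xi w) 0 0)%R] =
     'E_Q[fun w => (w.1 * w.2)%R])%E.
  by congr expectation; apply/funext => w; exact: quadratic_xi.
set v := Num.min (mu 0 0) _ in optP *.
exists v, v; split=> //.
- split; first by exists P => //; rewrite quadE optP.
  by move=> _ [Q feasQ ->]; rewrite quadE; exact: moment_feasible_le.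
- split.
  + have feasS : sdp_feasible mu sigma (\matrix_(i, j)
        (if i == j then mu i 0 ^+ 2 + sigma i 0 ^+ 2 else v)).
      have [/andP[m0 m0'] _ _] := feasible_paramsP 0 Hpar.
      have [/andP[m1 m1'] _ _] := feasible_paramsP 1 Hpar.
      apply: sdp_feasible_corr => //.
      * by move=> i; have [_ _] := feasible_paramsP i Hpar; lra.
      * by rewrite /v ge_min lexx.
      * by rewrite /v !ge_min lexx orbT.
      (* The product of the means is below all three bounds, since means lie in [[0, 1]] and
         deviations are nonnegative; hence the covariance [v - mu 0 0 * mu 1 0] is nonnegative. *)
      * rewrite /v !ge_min lexx !orbT andbT !le_min.
        by rewrite ler_piMr// ler_piMl// lerDl mulr_ge0.
    by eexists; [exact: feasS|rewrite mxdot_A2 ?mxE//; case: feasS].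
  + move=> _ [S feasS ->]; rewrite mxdot_A2; first exact: sdp_feasible_le.
    by case: feasS.
- by move=> Q; exact: moment_feasible_le.
- exists P; split=> // i; first by case/moment_feasibleP : feasP => _ ->.
  by rewrite varP /= sqrtr_sqr ger0_norm.
Qed.
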